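(* There exist two oriented knots $S,S'\subset S^3$, an isomorphism of metabelian quotients \[\Phi\colon \pi_S/\pi_S^{(2)}\to \pi_{S'}/\pi_{S'}^{(2)},\] and metabelian representations $\alpha',\beta'$ of $\pi_{S'}$ with values in $\mathrm{SU}(n_1)$ and $\mathrm{SU}(n_2)$ respectively (for some $n_1,n_2$) such that, for the induced metabelian representations $\alpha=\alpha'\circ\Phi$ and $\beta=\beta'\circ\Phi$ of $\pi_S$ (precomposed with the projections $\pi_S\to\pi_S/\pi_S^{(2)}$, $\pi_{S'}\to\pi_{S'}/\pi_{S'}^{(2)}$), \[\Delta_S^{\alpha}(t)\doteq\Delta_{S'}^{\alpha'}(t),\qquad \Delta_S^{\beta}(t)\doteq\Delta_{S'}^{\beta'}(t),\qquad\text{but}\qquad \Delta_S^{\alpha\otimes\beta}(t)\not\doteq\Delta_{S'}^{\alpha'\otimes\beta'}(t).\]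
   Context: For an oriented knot $K\subset S^3$, $X_K=S^3\setminus \nu K$ is the knot exterior and $\pi_K=\pi_1(X_K)$. For a group $\pi$, $\pi^{(0)}=\pi$, $\pi^{(i+1)}=[\pi^{(i)},\pi^{(i)}]$; a representation is metabelian if it factors through $\pi/\pi^{(2)}$. Twisted Alexander polynomial (Wada's invariant): let $\phi\colon\pi_K\to\mathbb Z$ send the oriented meridian to $1$, let $R$ be a UFD with quotient field $Q$, and $\alpha\colon\pi_K\to \mathrm{Aut}(V)$ with $V$ a finitely generated free $R$-module. Let $\alpha\otimes\phi\colon \pi_K\to\mathrm{Aut}(V\otimes_R R[t^{\pm1}])$, $g\mapsto (v\otimes f\mapsto \alpha(g)v\otimes t^{\phi(g)}f)$, extended linearly to $\mathbb Z[\pi_K]$ and entrywise to matrices. Choose a deficiency-one presentation $\pi_K=\langle g_1,\dots,g_{k+1}\mid r_1,\dots,r_k\rangle$, let $M=(\partial r_i/\partial g_j)$ be the $k\times(k+1)$ matrix of Fox derivatives (mapped to $\mathbb Z[\pi_K]$), $M_i$ the matrix with column $i$ deleted, where $\phi(g_i)\neq0$. Then $\Delta_K^\alpha(t)=\det((\alpha\otimes\phi)(M_i))\cdot\det((\alpha\otimes\phi)(1-g_i))^{-1}\in Q(t)$, well defined up to multiplication by $\pm t^k r$, $k\in\mathbb Z$, $r\in\det(\alpha(\pi_K))$. We write $f\doteq g$ if two such expressions agree up to this indeterminacy; for representations with determinant $1$ (as here, including the tensor products) this means equality up to a factor $\pm t^k$, $k\in\mathbb Z$. *)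

(* Defs.v *)
From HB Require Import structures.
From mathcomp Require Import all_boot all_order all_algebra all_field fraction.
From Stdlib Require Import Relation_Operators.
Set Implicit Arguments. Unset Strict Implicit. Unset Printing Implicit Defensive.
Import Order.TTheory GRing.Theory Num.Theory.
Local Open Scope ring_scope.

(* A letter (i, false) is the generator x_i, (i, true) is x_i^{-1}. *)
Definition word := seq (nat * bool).

Definition invw (u : word) : word := rev (map (fun l => (l.1, ~~ l.2)) u).

Definition subst (f : nat -> word) (w : word) : word :=
  flatten (map (fun l => if l.2 then invw (f l.1) else f l.1) w).

Definition comm (a b : word) : word := invw a ++ invw b ++ a ++ b.

Definition validw (n : nat) (w : word) : bool := all (fun l => (l.1 < n)%N) w.

(* A braid on n strands is a word in the Artin generators sigma_i (i+1 < n),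
   letter (i, false) = sigma_i, (i, true) = sigma_i^{-1}. *)
Definition braid := seq (nat * bool).

(* Artin action of a braid letter on the free group F_n *)
Definition sigma_img (s : nat * bool) (k : nat) : word :=
  let i := s.1 in
  if ~~ s.2 then
    (if k == i then [:: (i, false); (i.+1, false); (i, true)]
     else if k == i.+1 then [:: (i, false)] else [:: (k, false)])
  else
    (if k == i then [:: (i.+1, false)]
     else if k == i.+1 then [:: (i.+1, true); (i, false); (i.+1, false)]
     else [:: (k, false)]).

Fixpoint braid_act (b : braid) (k : nat) : word :=
  match b with
  | [::] => [:: (k, false)]
  | s :: b' => subst (braid_act b') (sigma_img s k)
  end.

(* Wirtinger-type relator x_i = beta(x_i) of the closure's group,
   written as beta(x_i) x_i^{-1}.  pi_1 of the exterior of the closure of b is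
   < x_0,...,x_{n-1} | braid_rel b i, i < n >, each x_i an oriented meridian. *)
Definition braid_rel (b : braid) (i : nat) : word := braid_act b i ++ [:: (i, true)].

Definition transp (i k : nat) : nat :=
  if k == i then i.+1 else if k == i.+1 then i else k.

Definition braid_perm (b : braid) (k : nat) : nat := foldr (fun s k => transp s.1 k) k b.

(* b is a braid on n strands whose closure is a knot (one component) *)
Definition knot_braid (n : nat) (b : braid) : Prop :=
  (0 < n)%N /\ all (fun s => (s.1.+1 < n)%N) b /\
  forall m, (0 < m)%N -> (m < n)%N -> iter m (braid_perm b) 0%N <> 0%N.

(* relators of pi/pi^(2): the knot relators and all double commutators
   [[a,b],[c,d]] (whose normal closure in F_n is F_n^(2)). *)
Definition metab_relator (n : nat) (b : braid) (r : word) : Prop :=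
  (exists i, (i < n)%N /\ r = braid_rel b i) \/
  (exists a1 a2 a3 a4 : word,
      [/\ validw n a1, validw n a2, validw n a3 & validw n a4] /\
      r = comm (comm a1 a2) (comm a3 a4)).

Inductive pres_step (R : word -> Prop) : word -> word -> Prop :=
| ps_free (u v : word) (x : nat) (e : bool) :
    pres_step R (u ++ v) (u ++ [:: (x, e); (x, ~~ e)] ++ v)
| ps_rel (u v r : word) : R r -> pres_step R (u ++ v) (u ++ r ++ v).

Definition pres_eq (R : word -> Prop) : word -> word -> Prop :=
  clos_refl_sym_trans word (pres_step R).

(* w (resp. v) gives the images of the generators under an isomorphism
   Phi : pi_S/pi_S^(2) -> pi_S'/pi_S'^(2) (resp. its inverse Psi). *)
Definition metab_iso (n : nat) (b : braid) (n' : nat) (b' : braid)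
    (w v : nat -> word) : Prop :=
  [/\ forall j, (j < n)%N -> validw n' (w j),
      forall k, (k < n')%N -> validw n (v k) &
      forall r, metab_relator n b r -> pres_eq (metab_relator n' b') (subst w r) [::]] /\
  [/\ 
forall r, metab_relator n' b' r -> pres_eq (metab_relator n b) (subst v r) [::],
      forall j, (j < n)%N -> pres_eq (metab_relator n b) (subst v (w j)) [:: (j, false)]
    & forall k, (k < n')%N -> pres_eq (metab_relator n' b') (subst w (v k)) [:: (k, false)]].

Definition evalw (R : comUnitRingType) (d : nat) (g : nat -> 'M[R]_d) (w : word) : 'M[R]_d :=
  foldr (fun l M => (if l.2 then invmx (g l.1) else g l.1) *m M) 1%:M w.

Definition SU (d : nat) (A : 'M[algC]_d) : Prop :=
  A *m (map_mx Num.conj_op A)^T = 1%:M /\ \det A = 1.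

Definition metab_SU_rep (n : nat) (b : braid) (d : nat) (A : nat -> 'M[algC]_d) : Prop :=
  (forall k, (k < n)%N -> SU (A k)) /\
  (forall r, metab_relator n b r -> evalw A r = 1%:M).

Definition kron (d1 d2 : nat) (A : 'M[algC]_d1) (B : 'M[algC]_d2) : 'M[algC]_(\sum_(i < d1) d2) :=
  \mxblock_(i < d1, j < d1) (A i j *: B).

Definition QT := {fraction {poly algC}}.

Definition tofracQ (p : {poly algC}) : QT := @FracField.tofrac _ p.

Definition tvar : QT := tofracQ 'X.

(* (alpha (x) phi)(x_k) = t * alpha(x_k), since every generator is a meridian *)
Definition twist_img (d : nat) (A : nat -> 'M[algC]_d) (k : nat) : 'M[QT]_d :=
  tvar *: map_mx (fun a : algC => tofracQ a%:P) (A k).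

Fixpoint fox (d : nat) (g : nat -> 'M[QT]_d) (w : word) (j : nat) : 'M[QT]_d :=
  match w with
  | [::] => 0
  | l :: w' =>
      let delta : 'M[QT]_d := (if l.1 == j then 1 else 0)%:M in
      if l.2 then - (delta *m invmx (g l.1)) + invmx (g l.1) *m fox g w' j
      else delta + g l.1 *m fox g w' j
  end.

(* Deficiency-one presentation: generators x_0..x_{n-1}, relators
   braid_rel b i for i < n-1 (the last one is a consequence of the others).
   Fox matrix with column 0 deleted: rows i < n-1, columns j+1 for j < n-1. *)
Definition wada (n : nat) (b : braid) (d : nat) (A : nat -> 'M[algC]_d) : QT :=
  let g := twist_img A in
  \det (\mxblock_(i < n.-1, j < n.-1) fox g (braid_rel b i) j.+1)
  / \det (1%:M - g 0%N).

Definition doteq (f h : QT) : Prop :=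
  exists (s : bool) (k : nat),
    f = (-1) ^+ s * tvar ^+ k * h \/ h = (-1) ^+ s * tvar ^+ k * f.

(* Main.v *)
(* Take S = S' = the sum of three trefoils, on four strands. Its Alexander module
   is a sum of three copies of L = Z[t,1/t]/(1 - t + t^2), and Phi is a linear
   automorphism of L^3 which is not induced by the geometry: since 1 - t + t^2
   kills every element of the module, any two elements of degree one of
   pi/pi^(2) satisfy the braid relation, so that x_2, x_3 may be replaced by
   x_1 x_0^-1 x_2 and x_0 x_1^-1 x_3.

   A vector of characters in (Z/3)^3 gives a dihedral representation, whose
   twisted Alexander polynomial is a product over the three summands of a factor
   which depends only on the vanishing of the coordinate. For characters a, b,
   the tensor product is the sum of the representations given by a + b and a - b,
   so its polynomial sees |supp a|, |supp b| and |supp a /\ supp b|. Here Phi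
   takes ((1,-1,0), (0,1,0)) to ((1,0,1), (0,1,0)): the sizes of the supports are
   preserved while that of their intersection drops. *)
Require Import Defs.
From HB Require Import structures.
From mathcomp Require Import all_boot all_order all_algebra all_field fraction.
From mathcomp Require Import boolp ring.
From Stdlib Require Import Relation_Operators.
Set Implicit Arguments. Unset Strict Implicit. Unset Printing Implicit Defensive.
Import Order.TTheory GRing.Theory Num.Theory.
Local Open Scope ring_scope.
Local Open Scope quotient_scope.

(** * The braid relation in metabelian groups *)

Section GroupEvaluation.
Local Open Scope group_scope.
Variable G : groupType.
Implicit Types (e : nat -> G) (u v w : word).

Definition geval e w : G :=
  foldr (fun l M => (if l.2 then (e l.1)^-1 else e l.1) * M) 1 w.

Lemma geval_cat e u v : geval e (u ++ v) = geval e u * geval e v.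
Proof. by elim: u => [|l u IH] /=; rewrite ?mul1g // IH mulgA. Qed.

Lemma geval_invw e u : geval e (invw u) = (geval e u)^-1.
Proof.
elim: u => [|[x []] u IH] /=; first by rewrite invg1.
  by rewrite /invw /= rev_cons -cats1 geval_cat IH /= mulg1 invgM invgK.
by rewrite /invw /= rev_cons -cats1 geval_cat IH /= mulg1 invgM.
Qed.

Lemma geval_subst e f w : geval e (subst f w) = geval (fun k => geval e (f k)) w.
Proof.
elim: w => [|[x s] w IH] //=; rewrite /subst /= geval_cat -/(subst f w) IH.
by case: s; rewrite ?geval_invw.
Qed.

Lemma geval_comm e u v : geval e (comm u v) = commg (geval e u) (geval e v).
Proof. by rewrite /comm !geval_cat !geval_invw /commg /conjg. Qed.

Lemma eq_geval e1 e2 w : e1 =1 e2 -> geval e1 w = geval e2 w.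
Proof. by move=> E; elim: w => //= l w ->; rewrite E. Qed.

Definition braided (x y : G) := x * y * x = y * x * y.

Lemma braidedC x y : braided x y -> braided y x.
Proof. by rewrite /braided => ->. Qed.

(** With x = x_i and y = x_{i+1}, the right-hand form is the closure relation read off a block of
    three letters [(i, true)]. *)
Lemma braidedP x y : braided x y <-> y^-1 * x^-1 * y * x * y = x.
Proof.
rewrite /braided; split=> E.
  have -> : y^-1 * x^-1 * y * x * y = y^-1 * x^-1 * (y * x * y) by rewrite !mulgA.
  by rewrite -E !mulgA mulgVK mulVg mul1g.
by rewrite -{2}E !mulgA mulgK mulgV mul1g.
Qed.

Section Metabelian.
Hypothesis metab : forall a b c d : G, commute (commg a b) (commg c d).

Let iscomm (h : G) := exists a b, h = commg a b.

Let commC h k : iscomm h -> iscomm k -> h * k = k * h.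
Proof. by move=> [a [b ->]] [c [d ->]]; exact: metab. Qed.

Let comm_conj h x : iscomm h -> iscomm (x * h * x^-1).
Proof.
move=> [a [b ->]]; exists (x * a * x^-1), (x * b * x^-1).
by rewrite /commg /conjg !invgM !invgK !mulgA !mulgVK.
Qed.

(** The braid relation says that xy conjugates x to y, so y/x is the commutator of the inverses of
    xy and x. *)
Let iscomm_braided x y : braided x y -> iscomm (y * x^-1).
Proof.
move=> E; exists (x * y)^-1, x^-1.
by rewrite /commg /conjg !invgK invgM !mulgA E !mulgK.
Qed.

(* With [p = a x], the braid relation for [x, p] says that [a - ta + t^2 a = 0]
   in the additive group of commutators, [t] being conjugation by [x]. *)
Let braidedE x a :
  braided x (a * x) <-> x * a * x^-1 = a * (x * (x * a * x^-1) * x^-1).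
Proof.
rewrite /braided; split=> E.
  apply: (mulIg x); apply: (mulIg x); apply: (mulIg x).
  by rewrite !mulgA !mulgVK; move: E; rewrite !mulgA => ->.
have {}E := congr1 (fun z => z * x * x * x) E.
by move: E; rewrite /= !mulgA !mulgVK.
Qed.

(** With p = ax and q = bx, the relation for p, q reads (1 - t + t^2)(a - b) = 0 additively, and
    both a and b are already killed by 1 - t + t^2. *)
Lemma braided_trans x p q : braided x p -> braided x q -> braided p q.
Proof.
move=> Bp Bq; have [Cp Cq] := (iscomm_braided Bp, iscomm_braided Bq).
rewrite -(mulgVK x p) -(mulgVK x q) in Bp Bq *.
move: Cp Cq Bp Bq; move: (p / x) (q / x) => a b {p q} Ca Cb.
move=> /braidedE Ea /braidedE Eb.
have Ca' := comm_conj x Ca; have Cb' := comm_conj x Cb.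
have Ca2 := comm_conj x Ca'; have Cb2 := comm_conj x Cb'.
(* Since ta = a + t^2 a, and likewise for b, both sides reduce to ta + tb. *)
suff E: a * (x * b * x^-1) * (x * (x * a * x^-1) * x^-1) =
        b * (x * a * x^-1) * (x * (x * b * x^-1) * x^-1).
  have {}E := congr1 (fun z => z * x * x * x) E.
  by move: E; rewrite /braided /= !mulgA !mulgVK.
rewrite -[LHS]mulgA (commC Cb' Ca2) [LHS]mulgA -Ea.
by rewrite -[RHS]mulgA (commC Ca' Cb2) [RHS]mulgA -Eb (commC Ca' Cb').
Qed.

(** Here p q^-1 r = (a - b + c)x, and the elements killed by 1 - t + t^2 form a subgroup. *)
Lemma braided_mix x p q r :
  braided x p -> braided x q -> braided x r -> braided x (p * q^-1 * r).
Proof.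
move=> Bp Bq Br.
have [Cp Cq Cr] := And3 (iscomm_braided Bp) (iscomm_braided Bq) (iscomm_braided Br).
have -> : p * q^-1 * r = (p / x) * (q / x)^-1 * (r / x) * x.
  by rewrite invgM invgK !mulgA !mulgVK.
rewrite -(mulgVK x p) -(mulgVK x q) -(mulgVK x r) in Bp Bq Br.
move: Cp Cq Cr Bp Bq Br; move: (p / x) (q / x) (r / x) => a b c {p q r}.
have [t tE] : exists t, forall h, t h = x * h * x^-1 by exists (fun h => x * h * x^-1).
move=> Ca Cb Cc.
move=> /braidedE; rewrite -!tE => Ea.
move=> /braidedE; rewrite -!tE => Eb.
move=> /braidedE; rewrite -!tE => Ec.
apply/braidedE; rewrite -!tE.
have tM h k : t (h * k) = t h * t k by rewrite !tE !mulgA mulgVK.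
have tV h : t h^-1 = (t h)^-1 by rewrite !tE !invgM invgK !mulgA.
have Ct h : iscomm h -> iscomm (t h) by rewrite tE; exact: comm_conj.
(* After this substitution only a reordering of commuting factors remains, with A, B, C standing for
   t^2 a, t^2 b, t^2 c. *)
rewrite !tM !tV {1}Ea {1}Eb {1}Ec invgM.
have [Cta Ctb] := (Ct _ (Ct _ Ca), Ct _ (Ct _ Cb)).
move: (t (t a)) (t (t b)) (t (t c)) Cta Ctb => A B C CA CB.
have CE h k : iscomm h -> iscomm k -> commute h k by exact: commC.
have CV h k : iscomm h -> iscomm k -> commute h k^-1 by move=> *; apply: commuteV; exact: CE.
have CVV h k : iscomm h -> iscomm k -> commute h^-1 k^-1.
  by move=> *; apply/commuteV/commute_sym/CV.
have E : commute (A * B^-1) (b^-1 * c).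
  apply/commute_sym; apply: commuteM; apply/commute_sym; apply: commuteM.
  - exact: CV.
  - exact: CE.
  - exact: CVV.
  - exact/commute_sym/CV.
have -> : a * A * (B^-1 * b^-1) * (c * C) = a * (A * B^-1 * (b^-1 * c)) * C.
  by rewrite !mulgA.
by rewrite E !mulgA.
Qed.

End Metabelian.

End GroupEvaluation.

(** * Sums of trefoils *)

(** Each block of three equal letters ties one trefoil summand. The blocks come in descending order,
    so that for i < m the image of x_i involves only x_0, ..., x_{i+1}; this makes the Fox matrix
    triangular. *)
Fixpoint trefoils m : braid :=
  if m is m'.+1 then nseq 3 (m', true) ++ trefoils m' else [::].

Lemma subst_cat f u v : subst f (u ++ v) = subst f u ++ subst f v.
Proof. by rewrite /subst map_cat flatten_cat. Qed.

Lemma subst1 f i : subst f [:: (i, false)] = f i.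
Proof. by rewrite /subst /= cats0. Qed.

Lemma invwK : involutive invw.
Proof.
move=> u; rewrite /invw map_rev revK -map_comp map_id_in // => -[x s] _ /=.
by rewrite negbK.
Qed.

Lemma invw_cat u v : invw (u ++ v) = invw v ++ invw u.
Proof. by rewrite /invw map_cat rev_cat. Qed.

Lemma subst_invw f u : subst f (invw u) = invw (subst f u).
Proof.
elim: u => [|[x s] u IH] //; rewrite -cat1s invw_cat !subst_cat IH invw_cat.
by congr (_ ++ _); rewrite /subst /=; case: s; rewrite /= !cats0 ?invwK.
Qed.

Lemma subst_subst f g u : subst f (subst g u) = subst (fun k => subst f (g k)) u.
Proof.
elim: u => [|[x s] u IH] //; rewrite -cat1s !subst_cat IH; congr (_ ++ _).
by rewrite /subst /=; case: s; rewrite /= !cats0 // -/(subst f _) subst_invw.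
Qed.

Lemma eq_subst f g u : f =1 g -> subst f u = subst g u.
Proof.
by move=> E; rewrite /subst; congr flatten; apply: eq_map => l; rewrite E.
Qed.

Lemma braid_act_cat b1 b2 k :
  braid_act (b1 ++ b2) k = subst (braid_act b2) (braid_act b1 k).
Proof.
elim: b1 k => [|s b1 IH] k /=; first by rewrite subst1.
by rewrite subst_subst; apply: eq_subst.
Qed.

Lemma trefoil_act_lo i :
  braid_act (nseq 3 (i, true)) i =
  [:: (i.+1, true); (i, true); (i.+1, false); (i.+1, false); (i.+1, true);
      (i, false); (i.+1, false)].
Proof.
have N : (i.+1 == i) = false by rewrite gtn_eqF.
by do 3 rewrite /= /sigma_img /= ?eqxx ?N /= /subst /= ?cats0.
Qed.

Lemma trefoil_act_fresh i k :
  k != i -> k != i.+1 -> braid_act (nseq 3 (i, true)) k = [:: (k, false)].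
Proof.
move=> /negPf N1 /negPf N2.
by do 3 rewrite /= /sigma_img /= ?N1 ?N2 /= /subst /= ?cats0.
Qed.

Lemma trefoils_act_fresh m k :
  (m < k)%N -> braid_act (trefoils m) k = [:: (k, false)].
Proof.
elim: m => // m IH lt_mk; rewrite /trefoils -/trefoils braid_act_cat.
by rewrite trefoil_act_fresh ?subst1 ?IH ?gtn_eqF // ltnW.
Qed.

(** The blocks above block i act first, and none of them moves x_i. *)
Lemma trefoils_act_lo m i :
  (i < m)%N -> braid_act (trefoils m) i = braid_act (trefoils i.+1) i.
Proof.
elim: m => // m IH; rewrite ltnS leq_eqVlt => /orP [/eqP -> //|lt_im].
rewrite /trefoils -/trefoils braid_act_cat trefoil_act_fresh ?subst1 ?IH //.
  by rewrite ltn_eqF.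
by rewrite ltn_eqF // ltnW.
Qed.

Lemma trefoils_act_last i :
  braid_act (trefoils i.+1) i =
  subst (fun k => if k == i then braid_act (trefoils i) i else [:: (k, false)])
    [:: (i.+1, true); (i, true); (i.+1, false); (i.+1, false); (i.+1, true);
        (i, false); (i.+1, false)].
Proof.
have N : (i.+1 == i) = false by rewrite gtn_eqF.
by rewrite /trefoils -/trefoils braid_act_cat trefoil_act_lo /subst /= eqxx N trefoils_act_fresh.
Qed.

Section GroupTrefoils.
Local Open Scope group_scope.
Variables (G : groupType) (e : nat -> G).

Lemma geval_trefoil i k : braided (e i) (e i.+1) ->
  geval e (braid_act (nseq 3 (i, true)) k) = e k.
Proof.
move=> /braidedP E; have N : (i.+1 == i) = false by rewrite gtn_eqF.
have [->|N1] := eqVneq k i.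
  by rewrite trefoil_act_lo /= mulg1 -[RHS]E !mulgA mulgK.
have [->|N2] := eqVneq k i.+1; last first.
  by rewrite trefoil_act_fresh //= mulg1.
have -> : geval e (braid_act (nseq 3 (i, true)) i.+1)
    = ((e i.+1)^-1 * (e i)^-1 * e i.+1 * e i * e i.+1)^-1 * e i * e i.+1.
  do 3 rewrite /= /sigma_img /= ?eqxx ?N /= /subst /= ?cats0.
  by rewrite mulg1 !invgM !invgK !mulgA !mulgK ?mulgVK.
by rewrite E mulVg mul1g.
Qed.

Lemma geval_trefoils m k : (forall i, (i < m)%N -> braided (e i) (e i.+1)) ->
  geval e (braid_act (trefoils m) k) = e k.
Proof.
elim: m k => [|m IH] k Be; first by rewrite /= mulg1.
rewrite /trefoils -/trefoils braid_act_cat geval_subst.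
rewrite (eq_geval (e2 := e)); last by move=> j; rewrite IH // => i /ltnW; exact: Be.
exact/geval_trefoil/Be.
Qed.

(** By induction the lower blocks act trivially, so the i-th closure relation reduces to that of
    block i alone. With [geval_trefoils], the closure relations amount to the braid relations
    between consecutive generators. *)
Lemma braided_trefoils m :
    (forall i, (i < m)%N -> geval e (braid_act (trefoils m) i) = e i) ->
  forall i, (i < m)%N -> braided (e i) (e i.+1).
Proof.
move=> He i; elim/ltn_ind: i => i IH lt_im; apply/braidedP.
rewrite -[RHS](He i lt_im) trefoils_act_lo // /trefoils -/trefoils.
rewrite braid_act_cat geval_subst (eq_geval (e2 := e)); last first.
  move=> j; apply: geval_trefoils => k lt_ki.
  exact: IH lt_ki (ltn_trans lt_ki lt_im).
by rewrite trefoil_act_lo /= mulg1 !mulgA mulgK.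
Qed.

End GroupTrefoils.

(** * The metabelian quotient as a group *)

Section MetabelianQuotient.
Variables (n : nat) (b : braid).
Hypothesis n_gt0 : (0 < n)%N.
Hypothesis b_valid : forall i, (i < n)%N -> validw n (braid_rel b i).

Let R := metab_relator n b.

(* [pres_eq] lives on words in all letters; those outside the presentation
   are folded onto [x_0], so that the quotient is really [pi/pi^(2)]. *)
Definition fold_letters (u : word) : word :=
  map (fun l => (if (l.1 < n)%N then l.1 else 0%N, l.2)) u.

Lemma fold_letters_valid u : validw n (fold_letters u).
Proof. by rewrite /validw all_map; apply/allP => l _ /=; case: ifP. Qed.

Lemma fold_letters_id u : validw n u -> fold_letters u = u.
Proof.
move=> /allP V; rewrite /fold_letters -[RHS]map_id.
by apply/eq_in_map => -[x s] /V /= ->.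
Qed.

Lemma fold_letters_cat u v :
  fold_letters (u ++ v) = fold_letters u ++ fold_letters v.
Proof. exact: map_cat. Qed.

Lemma fold_letters_invw u : fold_letters (invw u) = invw (fold_letters u).
Proof. by rewrite /fold_letters /invw map_rev -!map_comp. Qed.

Lemma pres_eq_cat u u' v v' :
  pres_eq R u u' -> pres_eq R v v' -> pres_eq R (u ++ v) (u' ++ v').
Proof.
have L w x y : pres_eq R x y -> pres_eq R (w ++ x) (w ++ y).
  elim=> [{}x {}y [p q i s|p q r Rr]|z|{}x {}y _|{}x y' {}y _ Hx _ Hy].
  - by apply: rst_step; rewrite !(catA w); constructor.
  - by apply: rst_step; rewrite !(catA w); constructor.
  - exact: rst_refl.
  - exact: rst_sym.
  - exact: rst_trans Hx Hy.
have L' w x y : pres_eq R x y -> pres_eq R (x ++ w) (y ++ w).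
  elim=> [{}x {}y [p q i s|p q r Rr]|z|{}x {}y _|{}x y' {}y _ Hx _ Hy].
  - by apply: rst_step; rewrite -!catA; constructor.
  - by apply: rst_step; rewrite -!catA; constructor.
  - exact: rst_refl.
  - exact: rst_sym.
  - exact: rst_trans Hx Hy.
move=> Hu Hv; apply: rst_trans (L' v _ _ Hu) _; exact: L.
Qed.

Lemma pres_eq_invl u : pres_eq R (invw u ++ u) [::].
Proof.
elim: u => [|[x s] u IH]; first exact: rst_refl.
rewrite -cat1s invw_cat -catA; apply: rst_trans IH; apply: rst_sym.
apply: rst_step.
have := ps_free R (invw u) u x (~~ s); rewrite negbK; exact.
Qed.

Lemma pres_eq_invr u : pres_eq R (u ++ invw u) [::].
Proof. by rewrite -{1}(invwK u); exact: pres_eq_invl. Qed.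

Definition same_class (u v : word) : bool :=
  `[< pres_eq R (fold_letters u) (fold_letters v) >].

Lemma same_class_refl : reflexive same_class.
Proof. by move=> u; apply/asboolP/rst_refl. Qed.

Lemma same_class_sym : symmetric same_class.
Proof. by move=> u v; apply/asboolP/asboolP; apply: rst_sym. Qed.

Lemma same_class_trans : transitive same_class.
Proof. by move=> v u w /asboolP H1 /asboolP H2; apply/asboolP/(rst_trans _ _ _ _ _ H1). Qed.

Canonical same_class_equiv :=
  EquivRel same_class same_class_refl same_class_sym same_class_trans.

Definition metab_group := {eq_quot same_class_equiv}.

HB.instance Definition _ := Choice.on metab_group.
HB.instance Definition _ := EqQuotient.on metab_group.

Definition cls (u : word) : metab_group := \pi_(metab_group) u.

Lemma cls_eqP u v : cls u = cls v <-> pres_eq R (fold_letters u) (fold_letters v).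
Proof.
split=> [/eqquotP/asboolP //|H]; apply/eqquotP; exact/asboolP.
Qed.

Lemma cls_repr (x : metab_group) : cls (repr x) = x.
Proof. exact: reprK. Qed.

Definition mg_one : metab_group := cls [::].
Definition mg_inv (x : metab_group) : metab_group := cls (invw (repr x)).
Definition mg_mul (x y : metab_group) : metab_group := cls (repr x ++ repr y).

Lemma mg_mulE u v : mg_mul (cls u) (cls v) = cls (u ++ v).
Proof.
apply/cls_eqP; rewrite !fold_letters_cat; apply: pres_eq_cat;
  by apply/cls_eqP; rewrite cls_repr.
Qed.

Lemma mg_mulA : associative mg_mul.
Proof.
by move=> x y z; rewrite -(cls_repr x) -(cls_repr y) -(cls_repr z) !mg_mulE catA.
Qed.

Lemma mg_mul1 : left_id mg_one mg_mul.
Proof. by move=> x; rewrite -(cls_repr x) mg_mulE. Qed.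

Lemma mg_mulr1 : right_id mg_one mg_mul.
Proof. by move=> x; rewrite -(cls_repr x) mg_mulE cats0. Qed.

Lemma mg_mulV : left_inverse mg_one mg_inv mg_mul.
Proof.
move=> x; rewrite -{2}(cls_repr x) mg_mulE; apply/cls_eqP.
by rewrite fold_letters_cat fold_letters_invw; exact: pres_eq_invl.
Qed.

Lemma mg_mulrV : right_inverse mg_one mg_inv mg_mul.
Proof.
move=> x; rewrite -{1}(cls_repr x) mg_mulE; apply/cls_eqP.
by rewrite fold_letters_cat fold_letters_invw; exact: pres_eq_invr.
Qed.

HB.instance Definition _ :=
  isGroup.Build metab_group mg_mulA mg_mul1 mg_mulr1 mg_mulV mg_mulrV.

Definition mgen k : metab_group := cls [:: (k, false)].

Lemma cls_invw u : ((cls u)^-1)%g = cls (invw u).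
Proof.
apply: (mulgI (cls u)); rewrite mulgV; apply/esym.
rewrite [LHS]mg_mulE; apply/cls_eqP.
by rewrite fold_letters_cat fold_letters_invw; exact: pres_eq_invr.
Qed.

Lemma geval_mgen u : geval mgen u = cls u.
Proof.
elim: u => [//|[x s] u IH]; rewrite /= IH -[(x, s) :: u]cat1s -mg_mulE.
by case: s; rewrite ?cls_invw.
Qed.

Lemma metab_group_metab (x y z w : metab_group) : commute (commg x y) (commg z w).
Proof.
have cE (u v : word) : commg (cls u) (cls v) = cls (comm u v).
  by rewrite -!geval_mgen geval_comm !geval_mgen.
rewrite -(cls_repr x) -(cls_repr y) -(cls_repr z) -(cls_repr w).
rewrite /commute [LHS]commgC !cE; set c := comm (comm _ _) _.
suff -> : cls c = 1%g by rewrite mulg1.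
apply/cls_eqP; set r := fold_letters c.
apply/rst_sym/rst_step; rewrite -[r]cats0; apply: (ps_rel [::] [::]); right.
exists (fold_letters (repr x)), (fold_letters (repr y)),
  (fold_letters (repr z)), (fold_letters (repr w)).
split; first by split; exact: fold_letters_valid.
by rewrite /r /c /comm !(fold_letters_cat, fold_letters_invw).
Qed.

Lemma braid_rel_cls i : (i < n)%N -> geval mgen (braid_act b i) = mgen i.
Proof.
move=> lt_in; have : cls (braid_rel b i) = 1%g.
  apply/cls_eqP; rewrite (fold_letters_id (b_valid lt_in)) /=.
  apply/rst_sym/rst_step; rewrite -[braid_rel b i]cats0.
  by apply: (ps_rel [::] [::]); left; exists i.
rewrite -geval_mgen geval_cat /= mulg1 => /(congr1 (fun z => z * mgen i)%g).
by rewrite mulgVK mul1g.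
Qed.

(** This turns identities computed in [metab_group] back into equivalences of words; validity
    ensures that folding changes neither word. *)
Lemma pres_eq_geval u v : validw n u -> validw n v ->
  geval mgen u = geval mgen v -> pres_eq R u v.
Proof.
by move=> Vu Vv; rewrite !geval_mgen => /cls_eqP; rewrite !fold_letters_id.
Qed.

End MetabelianQuotient.

(** * The exotic automorphism of the metabelian quotient *)

Definition slide (a c k : nat) : word :=
  match k with
  | 2 => [:: (c, false); (a, true); (2, false)]
  | 3 => [:: (a, false); (c, true); (3, false)]
  | _ => [:: (k, false)]
  end.

Local Notation R3 := (metab_relator 4 (trefoils 3)).

Lemma trefoils3_valid i : (i < 4)%N -> validw 4 (braid_rel (trefoils 3) i).
Proof. by case: i => [|[|[|[|i]]]] // _; vm_compute. Qed.

Lemma slide_valid a c k :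
  (a < 2)%N -> (c < 2)%N -> (k < 4)%N -> validw 4 (slide a c k).
Proof.
by case: a => [|[|a]] //; case: c => [|[|c]] //; case: k => [|[|[|[|k]]]].
Qed.

Lemma subst_valid n m f w :
    (forall k, (k < n)%N -> validw m (f k)) -> validw n w ->
  validw m (subst f w).
Proof.
move=> Vf; elim: w => //= -[x s] w IH /= /andP [Vx Vw].
rewrite /validw /subst /= all_cat -/(validw m (flatten _)) IH // andbT.
case: s; last exact: Vf.
by rewrite /invw all_rev all_map; exact: Vf.
Qed.

Lemma subst_comm f u v : subst f (comm u v) = comm (subst f u) (subst f v).
Proof. by rewrite /comm !subst_cat !subst_invw. Qed.

Lemma mgen_braided i : (i < 3)%N ->
  @braided (metab_group 4 (trefoils 3)) (mgen 4 _ i) (mgen 4 _ i.+1).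
Proof.
apply: braided_trefoils => k lt_k3.
by apply: (braid_rel_cls trefoils3_valid); apply: ltnW.
Qed.

(** Double commutators go to double commutators. For the knot relators, every generator is braided
    with x_0 by transitivity, hence so is every image by [braided_mix]; the images are then pairwise
    braided and satisfy the closure relations. *)
Lemma slide_relator a c r : (a < 2)%N -> (c < 2)%N -> R3 r ->
  pres_eq R3 (subst (slide a c) r) [::].
Proof.
move=> lt_a lt_c [[i [lt_i ->]]|[a1 [a2 [a3 [a4 [[V1 V2 V3 V4] ->]]]]]]; last first.
  rewrite !subst_comm; apply/rst_sym/rst_step; rewrite -[comm _ _]cats0.
  apply: (ps_rel [::] [::]); right.
  exists (subst (slide a c) a1), (subst (slide a c) a2),
    (subst (slide a c) a3), (subst (slide a c) a4).
  by split=> //; split; apply: subst_valid; eauto; move=> k; exact: slide_valid.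
apply: (pres_eq_geval (n := 4)) => //.
  by apply: subst_valid (trefoils3_valid lt_i) => k; exact: slide_valid.
rewrite geval_subst /braid_rel geval_cat geval_trefoils; first by rewrite /= mulg1 mulgV.
have mB := metab_group_metab (n := 4) (b := trefoils 3) isT.
have B0k k : (k < 4)%N -> braided (mgen 4 (trefoils 3) 0) (mgen 4 _ k).
  have B01 := mgen_braided (i := 0) isT.
  have B02 : braided (mgen 4 (trefoils 3) 0) (mgen 4 _ 2).
    exact: (braided_trans mB (braidedC B01) (mgen_braided (i := 1) isT)).
  have B03 : braided (mgen 4 (trefoils 3) 0) (mgen 4 _ 3).
    exact: (braided_trans mB (braidedC B02) (mgen_braided (i := 2) isT)).
  by case: k => [|[|[|[|k]]]].
have lt4 k : (k < 2)%N -> (k < 4)%N by move=> /leq_trans; exact.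
move=> k lt_k3; apply: (braided_trans mB (x := mgen 4 _ 0)).
  by case: k lt_k3 => [|[|[|k]]] // _; rewrite /= mulg1 ?mulgA;
    [exact: B0k..|apply: (braided_mix mB); apply: B0k; auto].
by case: k lt_k3 => [|[|[|k]]] // _; rewrite /= mulg1 ?mulgA;
  [exact: B0k|apply: (braided_mix mB); apply: B0k; auto..].
Qed.

(** Both maps fix x_0 and x_1, and exchanging [a] and [c] inverts the factors put in front of x_2
    and x_3. *)
Lemma slideK a c k : (a < 2)%N -> (c < 2)%N -> (k < 4)%N ->
  pres_eq R3 (subst (slide c a) (slide a c k)) [:: (k, false)].
Proof.
move=> lt_a lt_c lt_k; apply: (pres_eq_geval (n := 4)).
- by apply: subst_valid (slide_valid lt_a lt_c lt_k) => j; exact: slide_valid.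
- by rewrite /validw /= lt_k.
case: k lt_k => [|[|[|[|k]]]] // _;
  case: a lt_a => [|[|a]] // _; case: c lt_c => [|[|c]] // _ /=;
  by rewrite ?mulg1 ?mulgK ?mulKVg ?mulKg ?mulVKg.
Qed.

Lemma slide_metab_iso : metab_iso 4 (trefoils 3) 4 (trefoils 3) (slide 0 1) (slide 1 0).
Proof.
split; split; try by move=> *; exact: slide_valid.
- by move=> r; apply: slide_relator.
- by move=> r; apply: slide_relator.
- by move=> j; apply: slideK.
- by move=> j; apply: slideK.
Qed.

Lemma trefoils3_knot : knot_braid 4 (trefoils 3).
Proof.
split; first by []; split; first by [].
case=> [|[|[|[|m]]]] m_gt0 lt_m4; first by discriminate m_gt0.
1-3: by apply/eqP; vm_compute.
by discriminate lt_m4.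
Qed.

(** * Matrix representations *)

Section MatrixGroup.
Variables (R : comUnitRingType) (d : nat).

(** Invertible matrices are packaged as a group so that the word identities proved for abstract
    groups apply to [evalw]. *)
Definition gl_group := {A : 'M[R]_d | A \in unitmx}.
HB.instance Definition _ := Choice.on gl_group.

Let glmul (A B : gl_group) : gl_group :=
  exist _ (val A *m val B) (etrans (unitmx_mul _ _) (introT andP (conj (valP A) (valP B)))).
Let glone : gl_group := exist _ 1%:M (unitmx1 R d).
Let glinv (A : gl_group) : gl_group :=
  exist _ (invmx (val A)) (etrans (unitmx_inv _) (valP A)).

Let glmulA : associative glmul.
Proof. by move=> A B C; apply: val_inj; rewrite /= mulmxA. Qed.
Let glmul1 : left_id glone glmul.
Proof. by move=> A; apply: val_inj; rewrite /= mul1mx. Qed.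
Let glmulr1 : right_id glone glmul.
Proof. by move=> A; apply: val_inj; rewrite /= mulmx1. Qed.
Let glmulV : left_inverse glone glinv glmul.
Proof. by move=> A; apply: val_inj; rewrite /= mulVmx ?(valP A). Qed.
Let glmulrV : right_inverse glone glinv glmul.
Proof. by move=> A; apply: val_inj; rewrite /= mulmxV ?(valP A). Qed.

HB.instance Definition _ :=
  isGroup.Build gl_group glmulA glmul1 glmulr1 glmulV glmulrV.

Lemma evalw_geval (e : nat -> gl_group) (w : word) :
  evalw (fun k => val (e k)) w = val (geval e w).
Proof. by elim: w => // -[x s] w IH; rewrite /= IH; case: s. Qed.

Definition braided_mx (X Y : 'M[R]_d) := X *m Y *m X = Y *m X *m Y.

Variable g : nat -> 'M[R]_d.
Hypothesis g_unit : forall k, g k \in unitmx.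

Let e k : gl_group := exist _ (g k) (g_unit k).

Lemma evalw_cat u v : evalw g (u ++ v) = evalw g u *m evalw g v.
Proof. by elim: u => [|l u IH] /=; rewrite ?mul1mx // IH mulmxA. Qed.

Lemma evalw_invw w : evalw g (invw w) = invmx (evalw g w).
Proof. by rewrite !(evalw_geval e) geval_invw. Qed.

Lemma evalw_trefoils m k :
    (forall i, (i < m)%N -> braided_mx (g i) (g i.+1)) ->
  evalw g (braid_act (trefoils m) k) = g k.
Proof.
move=> Bg; rewrite (evalw_geval e) geval_trefoils // => i /Bg E.
exact: val_inj.
Qed.

Lemma evalw_comm_comm a b c f :
    commute (geval e (comm a b)) (geval e (comm c f)) ->
  evalw g (comm (comm a b) (comm c f)) = 1%:M.
Proof.
by move=> E; rewrite (evalw_geval e) geval_comm /commg /conjg E mulKg mulVg.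
Qed.

End MatrixGroup.

(** * Fox calculus and Wada's invariant *)

Section Fox.
Variables (d : nat) (g : nat -> 'M[QT]_d).
Hypothesis g_unit : forall k, g k \in unitmx.

Lemma fox_cat u v j : fox g (u ++ v) j = fox g u j + evalw g u *m fox g v j.
Proof.
elim: u => [|[x s] u IH] /=; first by rewrite add0r mul1mx.
by case: s; rewrite IH mulmxDr !mulmxA addrA.
Qed.

(** The derivative of a word followed by its inverse vanishes, because each cancelling pair
    contributes zero; the product rule then gives the formula. *)
Lemma fox_invw w j : fox g (invw w) j = - (invmx (evalw g w) *m fox g w j).
Proof.
rewrite -(evalw_invw g_unit); apply/eqP; rewrite -addr_eq0 -fox_cat; apply/eqP.
elim: w => [//|[x s] w IH].
rewrite -cat1s invw_cat -catA fox_cat catA fox_cat.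
have -> : fox g (invw [:: (x, s)] ++ [:: (x, s)]) j = 0.
  case: s; rewrite /= !mulmx0 !addr0 ?mulmxN; last by rewrite scalar_mxC addNr.
  by rewrite mulmxA scalar_mxC mulmxK ?subrr.
have -> : evalw g (invw [:: (x, s)] ++ [:: (x, s)]) = 1%:M.
  by case: s; rewrite /= mulmx1 ?mulmxV ?mulVmx.
by rewrite add0r mul1mx -fox_cat.
Qed.

Lemma fox_fresh w j : all (fun l => l.1 != j) w -> fox g w j = 0.
Proof.
elim: w => //= -[x s] w IH /= /andP [/negPf -> /IH ->].
have -> : (0 : QT)%:M = 0 :> 'M_d by rewrite raddf0.
by case: s; rewrite ?mul0mx ?oppr0 mulmx0 addr0.
Qed.

End Fox.

(** * Triangularity of the Fox matrix of a sum of trefoils *)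

Lemma braid_act_valid n b k :
  all (fun s => s.1.+1 < n)%N b -> (k < n)%N -> validw n (braid_act b k).
Proof.
move=> + lt_kn; elim: b k lt_kn => [|[x s] b IH] k lt_kn /=.
  by rewrite /validw /= lt_kn.
move=> /andP [lt_x Vb]; apply: (@subst_valid n) => [j lt_j|]; first exact: IH.
have lt_x' := ltnW lt_x.
by case: s; rewrite /sigma_img /=; do 2?[case: eqP => _]; rewrite /validw /= ?lt_x ?lt_x' ?lt_kn.
Qed.

Lemma trefoils_letters m : all (fun s => s.1.+1 < m.+1)%N (trefoils m).
Proof.
elim: m => // m IH; rewrite /trefoils -/trefoils all_cat /= ltnSn /=.
by apply: sub_all IH => s; exact: ltnW.
Qed.

Lemma trefoils_act_valid m i : (i < m)%N -> validw i.+2 (braid_act (trefoils m) i).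
Proof.
by move=> /trefoils_act_lo ->; exact: braid_act_valid (trefoils_letters _) _.
Qed.

(* The left-hand side is what the Fox rules give for the derivative of
   [y^-1 x^-1 y y y^-1 x y] with respect to [y]. *)
Lemma fox_trefoil_sum (R : comUnitRingType) d (X Y : 'M[R]_d) :
    X \in unitmx -> Y \in unitmx ->
  - (invmx Y *m 1%:M) + invmx Y *m (- (invmx X *m 0) + invmx X *m
     (1%:M + Y *m (1%:M + Y *m (- (invmx Y *m 1%:M) + invmx Y *m (0 + X *m 1%:M)))))
  = invmx Y *m invmx X *m (1%:M - X + Y *m X).
Proof.
move=> Xu Yu; rewrite !mulmx1 mulmx0 oppr0 !add0r.
rewrite [Y *m (- _ + _)]mulmxDr mulmxN mulmxV // mulKVmx // addrA subrr add0r.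
rewrite addrAC [RHS]mulmxDr mulmxN -[invmx Y *m invmx X *m X]mulmxA mulVmx //.
by rewrite mulmx1 mulmxA [LHS]addrC.
Qed.

Lemma det_castmx (F : comPzRingType) (p q : nat) (e : (p = q) * (p = q)) (A : 'M[F]_p) :
  \det (castmx e A) = \det A.
Proof. by case: e => e1 e2; subst q; rewrite castmx_id. Qed.

Lemma det_lower_mxblock (F : comPzRingType) (p q : nat) (B : 'I_p -> 'I_p -> 'M[F]_q) :
    (forall i j : 'I_p, (i < j)%N -> B i j = 0) ->
  \det (\mxblock_(i < p, j < p) B i j) = \prod_(i < p) \det (B i i).
Proof.
elim: p B => [|p IH] B B0.
  have E : (\sum_(i < 0) q)%N = 0%N by rewrite big_ord0.
  by rewrite big_ord0 -(det_castmx (E, E)) det_mx00.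
rewrite mxblock_recul det_castmx [X in block_mx _ X](_ : _ = 0); last first.
  by apply/matrixP => i j; rewrite !mxE B0 ?mxE.
rewrite det_lblock big_ord_recl; congr (_ * _); apply: IH => i j lt_ij.
exact: B0.
Qed.

Lemma det_mul_invmx (R : comUnitRingType) d (X Y Z : 'M[R]_d) :
  \det (invmx Y *m invmx X *m Z) = (\det Y)^-1 * (\det X)^-1 * \det Z.
Proof. by rewrite !det_mulmx !det_inv. Qed.

Section WadaTrefoils.
Variables (d m : nat) (g : nat -> 'M[QT]_d).
Hypothesis g_unit : forall k, g k \in unitmx.
Hypothesis g_braided : forall i, (i < m)%N -> braided_mx (g i) (g i.+1).

(** Column j stands for x_{j+1}, column 0 having been deleted, while relator i has no letter beyond
    x_{i+1}. *)
Lemma fox_trefoils_upper i j : (i < j)%N -> (i < m)%N ->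
  fox g (braid_rel (trefoils m) i) j.+1 = 0.
Proof.
move=> lt_ij lt_im; apply: fox_fresh; rewrite all_cat /= ltn_eqF ?andbT; last first.
  exact: ltnW.
apply: sub_all (trefoils_act_valid lt_im) => l /= lt_l.
by rewrite ltn_eqF // (leq_trans lt_l).
Qed.

(** The lower blocks replace x_i by a word [P] free of x_{i+1} whose value is still [g i], so the
    entry is that of a single trefoil on two strands. *)
Lemma fox_trefoils_diag i : (i < m)%N ->
  fox g (braid_rel (trefoils m) i) i.+1 =
  invmx (g i.+1) *m invmx (g i) *m (1%:M - g i + g i.+1 *m g i).
Proof.
move=> lt_im; rewrite fox_cat.
have -> : fox g [:: (i, true)] i.+1 = 0 by apply: fox_fresh; rewrite /= ltn_eqF.
rewrite mulmx0 addr0.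
have N : (i.+1 == i) = false by rewrite gtn_eqF.
rewrite trefoils_act_lo // trefoils_act_last; set P := braid_act _ _.
have fP : fox g P i.+1 = 0.
  apply: fox_fresh; have : validw i.+1 P.
    exact: braid_act_valid (trefoils_letters i) _.
  by apply: sub_all => l /= lt_l; rewrite ltn_eqF.
have eP : evalw g P = g i.
  by apply: evalw_trefoils => // k lt_ki; apply: g_braided; exact: ltn_trans lt_im.
rewrite /subst /= eqxx N -/P cats0.
have fQ : fox g [:: (i.+1, false)] i.+1 = 1%:M by rewrite /= eqxx mulmx0 addr0.
have eQ : evalw g [:: (i.+1, false)] = g i.+1 by rewrite /= mulmx1.
move: [:: (i.+1, false)] fQ eQ => Q fQ eQ.
rewrite !(fox_cat, fox_invw g_unit, evalw_invw g_unit) fP fQ eP eQ.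
exact: fox_trefoil_sum.
Qed.

Lemma det_fox_trefoils :
  \det (\mxblock_(i < m, j < m) fox g (braid_rel (trefoils m) i) j.+1) =
  \prod_(i < m) ((\det (g i.+1))^-1 * (\det (g i))^-1 *
                  \det (1%:M - g i + g i.+1 *m g i)).
Proof.
rewrite det_lower_mxblock => [|i j lt_ij]; last exact: fox_trefoils_upper.
apply: eq_bigr => i _; rewrite (fox_trefoils_diag (ltn_ord i)).
exact: det_mul_invmx.
Qed.

End WadaTrefoils.

Lemma tvar_neq0 : tvar != 0.
Proof. by rewrite /tvar /tofracQ tofrac_eq0 polyX_eq0. Qed.

Definition toQT : algC -> QT := fun a => tofracQ a%:P.

HB.instance Definition _ := GRing.RMorphism.copy toQT (@tofrac {poly algC} \o polyC).

Lemma twist_imgE d (A : nat -> 'M[algC]_d) k :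
  twist_img A k = tvar *: map_mx toQT (A k).
Proof. by []. Qed.

Lemma twist_img_unit d (A : nat -> 'M[algC]_d) k :
  A k \in unitmx -> twist_img A k \in unitmx.
Proof.
by move=> Au; rewrite twist_imgE unitmxZ ?unitfE ?tvar_neq0 // map_unitmx.
Qed.

Lemma twist_img_braided d (A : nat -> 'M[algC]_d) k l :
  braided_mx (A k) (A l) -> braided_mx (twist_img A k) (twist_img A l).
Proof.
rewrite /braided_mx !twist_imgE => E.
by rewrite -!(scalemxAl, scalemxAr) -!map_mxM E.
Qed.

Lemma wada_trefoils (m d : nat) (A : nat -> 'M[algC]_d) :
    (forall k, A k \in unitmx) ->
    (forall i, (i < m)%N -> braided_mx (A i) (A i.+1)) ->
  wada m.+1 (trefoils m) A =
    (\prod_(i < m) ((\det (twist_img A i.+1))^-1 * (\det (twist_img A i))^-1 *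
       \det (1%:M - twist_img A i + twist_img A i.+1 *m twist_img A i)))
    / \det (1%:M - twist_img A 0).
Proof.
move=> Au Ab; rewrite /wada /=; congr (_ / _).
have gu k : twist_img A k \in unitmx by exact: twist_img_unit.
have gb i : (i < m)%N -> braided_mx (twist_img A i) (twist_img A i.+1).
  by move=> lt_im; apply/twist_img_braided/Ab.
exact: det_fox_trefoils.
Qed.

(** * Determinants of antidiagonal matrices and their Kronecker products *)

Section SmallDeterminants.
Variable R : comNzRingType.

Lemma det_mx22 (A : 'M[R]_2) : \det A = A 0 0 * A 1 1 - A 0 1 * A 1 0.
Proof.
rewrite (expand_det_row _ 0) !big_ord_recl big_ord0 /cofactor !det_mx11 !mxE /=.
have -> : lift 0 (0 : 'I_1) = 1 :> 'I_2 by exact: val_inj.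
have -> : lift 1 (0 : 'I_1) = 0 :> 'I_2 by exact: val_inj.
by rewrite addr0 mul1r expr1 mulN1r mulrN.
Qed.

(** The indices split into the pairs {0,3} and {1,2}. Combinations of Kronecker products of two
    diagonal or two antidiagonal 2 by 2 matrices have this shape. *)
Lemma det_cross (f : nat -> nat -> R) :
    (forall i j, (i < 4)%N -> (j < 4)%N -> i != j -> (i + j != 3)%N -> f i j = 0) ->
  \det (\matrix_(i < 4, j < 4) f i j) =
    (f 0 0 * f 3 3 - f 0 3 * f 3 0) * (f 1 1 * f 2 2 - f 1 2 * f 2 1).
Proof.
move=> f0.
rewrite (expand_det_row _ 0) !big_ord_recl big_ord0 !mxE /= /bump /=.
rewrite (f0 0 1)%N // (f0 0 2)%N // !mul0r !add0r addr0 /cofactor /=.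
do 2 rewrite (expand_det_row _ 0) !big_ord_recl big_ord0 !mxE /= /bump /=.
rewrite /cofactor /= !det_mx22 !mxE /= /bump /= !(add0n, addn0, add1n).
rewrite (f0 1 0)%N // (f0 1 3)%N //.
rewrite (f0 2 0)%N // (f0 2 3)%N // (f0 3 1)%N // (f0 3 2)%N //.
ring.
Qed.

End SmallDeterminants.
Import tagnat.
Section Kronecker.
Lemma kron_entry (d1 d2 : nat) (A : 'M[algC]_d1) (B : 'M[algC]_d2) i j k l :
  kron A B (@Rank _ (fun=> d2) i k) (@Rank _ (fun=> d2) j l) = A i j * B k l.
Proof.
have := mxblockK (fun i j : 'I_d1 => A i j *: B) i j.
by move=> /matrixP/(_ k l); rewrite !mxE.
Qed.

Lemma kron_mul (d1 d2 : nat) (A A' : 'M[algC]_d1) (B B' : 'M[algC]_d2) :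
  kron A B *m kron A' B' = kron (A *m A') (B *m B').
Proof.
rewrite /kron mul_mxblock; apply: eq_mxblock => i j.
rewrite mxE scaler_suml; apply: eq_bigr => k _.
by rewrite -scalemxAl -scalemxAr scalerA.
Qed.

Lemma kron_opp (d1 d2 : nat) (A : 'M[algC]_d1) (B : 'M[algC]_d2) :
  kron (- A) (- B) = kron A B.
Proof. by apply: eq_mxblock => i j; rewrite mxE scaleNr scalerN opprK. Qed.

Lemma kron1 (d1 d2 : nat) : kron 1%:M 1%:M = 1%:M :> 'M_(\sum_(i < d1) d2).
Proof.
rewrite -mxdiagZ; apply: eq_mxblock => i j; rewrite mxE.
by case: (i == j); rewrite ?scale1r ?scale0r ?conform_mx_id.
Qed.

(** The size of a block matrix is a formal sum; index k < 4 is position [k %% 2] in block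
    [k %/ 2]. *)
Lemma det_sum2 (R : comNzRingType) (M : 'M[R]_(\sum_(i < 2) 2)) :
  \det M = \det (\matrix_(i < 4, j < 4)
    M (@Rank _ (fun=> 2) (inord (i %/ 2)) (inord (i %% 2)))
      (@Rank _ (fun=> 2) (inord (j %/ 2)) (inord (j %% 2)))).
Proof.
have e : (\sum_(i < 2) 2 = 4)%N by rewrite !big_ord_recl big_ord0.
rewrite -(det_castmx (e, e) M); congr (\det _); apply/matrixP => i j.
have E (k : 'I_4) : cast_ord (esym e) k = @Rank _ (fun=> 2) (inord (k %/ 2)) (inord (k %% 2)).
  apply: val_inj; rewrite [RHS]RankEsum /= big_mkcond !big_ord_recl big_ord0 /=.
  by case: k => [[|[|[|[|k]]]] lt_k] //=; rewrite !inordK.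
by rewrite castmxE mxE !E.
Qed.

End Kronecker.

(** A reflection of the dihedral group, lifted to determinant one: the sign makes its square -1. *)
Definition anti (F : fieldType) (z : F) : 'M[F]_2 :=
  \matrix_(i, j) if i == j then 0 else if i == 0 then z else - z^-1.

Section Anti.
Variable F : fieldType.
Implicit Types x y z : F.

Lemma det_anti z : z != 0 -> \det (anti z) = 1.
Proof. by move=> z0; rewrite det_mx22 !mxE /=; field. Qed.

Lemma anti_unit z : z != 0 -> anti z \in unitmx.
Proof. by move=> z0; rewrite unitmxE det_anti ?unitr1. Qed.

Lemma anti_mul x y : anti x *m anti y =
  \matrix_(i, j) if i == j then if i == 0 then - (x / y) else - (y / x) else 0.
Proof.
apply/matrixP => i j; rewrite !mxE !big_ord_recl big_ord0 !mxE.
by case: i => [[|[|i]] lt_i] //; case: j => [[|[|j]] lt_j] //=; rewrite -?val_eqE /=; ring.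
Qed.

Lemma invmx_anti z : z != 0 -> invmx (anti z) = - anti z.
Proof.
move=> z0; apply: (can_inj (mulKmx (anti_unit z0))).
rewrite mulmxV ?anti_unit // mulmxN anti_mul.
apply/matrixP => i j; rewrite !mxE divff //.
by case: i => [[|[|i]] lt_i] //; case: j => [[|[|j]] lt_j] //=;
  rewrite -?val_eqE /= ?opprK ?oppr0.
Qed.

Lemma anti_sqr z : z != 0 -> anti z *m anti z = - 1%:M.
Proof.
by move=> z0; rewrite -(mulmxV (anti_unit z0)) invmx_anti // mulmxN opprK.
Qed.

(** This is how [slide] acts on dihedral representations: the exponents of a root of unity combine
    as x - y + z. *)
Lemma anti_mul_inv_mul x y z : x != 0 -> y != 0 -> z != 0 ->
  anti x *m (invmx (anti y) *m anti z) = anti (x / y * z).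
Proof.
move=> x0 y0 z0; rewrite invmx_anti //.
rewrite mulNmx mulmxN; apply/matrixP => i j; rewrite anti_mul !mxE !big_ord_recl big_ord0 !mxE.
by case: i => [[|[|i]] lt_i] //; case: j => [[|[|j]] lt_j] //=;
  rewrite -?val_eqE /=; field; rewrite ?x0 ?y0 ?z0.
Qed.

Lemma anti_braided x y : x != 0 -> y != 0 -> x ^+ 3 = y ^+ 3 ->
  braided_mx (anti x) (anti y).
Proof.
move=> x0 y0 E; rewrite /braided_mx !anti_mul.
have E1 : x / y * x = y / x * y.
  apply: (mulIf (mulf_neq0 x0 y0)); transitivity (x ^+ 3); first by field.
  by rewrite E; field.
have E2 : y / x * x^-1 = x / y * y^-1.
  apply: (mulIf (mulf_neq0 x0 y0)); apply: (mulIf (mulf_neq0 x0 y0)).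
  transitivity (y ^+ 3); first by field; rewrite x0.
  by rewrite -E; field; rewrite y0.
apply/matrixP => i j; rewrite !mxE !big_ord_recl !big_ord0 !mxE.
case: i => [[|[|i]] lt_i] //; case: j => [[|[|j]] lt_j] //=; rewrite -?val_eqE /=;
  by rewrite ?(mulr0, mul0r, addr0, add0r) // ?mulrNN ?mulNr ?E1 ?E2.
Qed.

(** Only x/y + y/x enters: for cube roots of unity it is 2 if x = y and -1 otherwise. *)
Lemma det_alexander_anti t x y : x != 0 -> y != 0 ->
  \det (1%:M - t *: anti x + (t *: anti y) *m (t *: anti x)) =
  1 + t ^+ 2 * (1 - y / x - x / y) + t ^+ 4.
Proof.
move=> x0 y0; rewrite -scalemxAl -scalemxAr anti_mul det_mx22 !mxE /=.
by field; rewrite x0 y0.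
Qed.

End Anti.

Lemma map_anti (F F' : fieldType) (f : {rmorphism F -> F'}) z :
  map_mx f (anti z) = anti (f z).
Proof.
apply/matrixP => i j; rewrite !mxE.
by do 2?case: ifP => _; rewrite ?rmorph0 ?rmorphN ?fmorphV.
Qed.


Section KroneckerAnti.
Variables (F : fieldType) (f : {rmorphism algC -> F}) (t : F).

Let K x y : 'M[F]_(\sum_(i < 2) 2) := t *: map_mx f (kron (anti x) (anti y)).

Let scale_map_entry d (M : 'M[algC]_d) a b : (t *: map_mx f M) a b = t * f (M a b).
Proof. by rewrite !mxE. Qed.

Let lin_map_entry d (L M N : 'M[algC]_d) a b :
  (map_mx f L - t *: map_mx f M + t ^+ 2 *: map_mx f N) a b =
  f (L a b) - t * f (M a b) + t ^+ 2 * f (N a b).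
Proof. by rewrite !mxE. Qed.

Lemma det_kron_anti x y : x != 0 -> y != 0 -> \det (K x y) = t ^+ 4.
Proof.
move=> x0 y0; rewrite det_sum2.
pose h i j : F := t * f (anti x (inord (i %/ 2)) (inord (j %/ 2)) *
                         anti y (inord (i %% 2)) (inord (j %% 2))).
rewrite (_ : \matrix_(i, j) _ = \matrix_(i < 4, j < 4) h i j); last first.
  by apply/matrixP => i j; rewrite [LHS]mxE [RHS]mxE scale_map_entry kron_entry.
have [fx0 fy0] : f x != 0 /\ f y != 0 by rewrite !fmorph_eq0.
rewrite det_cross.
  rewrite /h /= !mxE -!val_eqE /= !inordK //= !(rmorphM, rmorphN, rmorph0, fmorphV).
  by field; rewrite fx0 fy0.
by move=> [|[|[|[|i]]]] [|[|[|[|j]]]] //= _ _ _ _;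
  rewrite /h !mxE -!val_eqE /= !inordK //= ?(mul0r, mulr0) rmorph0 mulr0.
Qed.

(** The two factors come from the index pairs {0,3} and {1,2}, which carry the summands a + b and a
    - b of the tensor product. *)
Lemma det_alexander_kron_anti x y x' y' :
    x != 0 -> y != 0 -> x' != 0 -> y' != 0 ->
  \det (1%:M - K x y + K x' y' *m K x y) =
  (1 + t ^+ 2 * (f (x' / x * (y' / y)) + f (x / x' * (y / y')) - 1) + t ^+ 4) *
  (1 + t ^+ 2 * (f (x' / x * (y / y')) + f (x / x' * (y' / y)) - 1) + t ^+ 4).
Proof.
move=> x0 y0 x'0 y'0; rewrite det_sum2.
have fx0 : f x != 0 by rewrite fmorph_eq0.
have fy0 : f y != 0 by rewrite fmorph_eq0.
have fx'0 : f x' != 0 by rewrite fmorph_eq0.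
have fy'0 : f y' != 0 by rewrite fmorph_eq0.
pose h i j : F :=
  f ((1%:M : 'M_2) (inord (i %/ 2)) (inord (j %/ 2)) *
     (1%:M : 'M_2) (inord (i %% 2)) (inord (j %% 2))) -
  t * f (anti x (inord (i %/ 2)) (inord (j %/ 2)) *
         anti y (inord (i %% 2)) (inord (j %% 2))) +
  t ^+ 2 * f ((anti x' *m anti x) (inord (i %/ 2)) (inord (j %/ 2)) *
              (anti y' *m anti y) (inord (i %% 2)) (inord (j %% 2))).
rewrite (_ : \matrix_(i, j) _ = \matrix_(i < 4, j < 4) h i j); last first.
  have -> : K x' y' *m K x y =
      t ^+ 2 *: map_mx f (kron (anti x' *m anti x) (anti y' *m anti y)).
    by rewrite -scalemxAl -scalemxAr scalerA -map_mxM kron_mul.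
  have -> : 1%:M = map_mx f (kron 1%:M 1%:M) :> 'M_(\sum_(i < 2) 2).
    by rewrite kron1 map_mx1.
  apply/matrixP => i j; rewrite [LHS]mxE [RHS]mxE lin_map_entry !kron_entry.
  by [].
rewrite det_cross.
  rewrite /h /= !anti_mul !mxE -!val_eqE /= !inordK //=.
  rewrite !(rmorphM, rmorphN, rmorph0, rmorph1, fmorphV, rmorph_nat).
  by field; rewrite fx0 fy0 fx'0 fy'0.
by move=> [|[|[|[|i]]]] [|[|[|[|j]]]] //= _ _ _ _;
  rewrite /h !anti_mul !mxE -!val_eqE /= !inordK //= ?(mul0r, mulr0) rmorph0 !mulr0 subrr addr0.
Qed.

End KroneckerAnti.

(** * Dihedral representations *)

Section DihedralRepresentation.
Variable z : nat -> algC.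
Hypothesis z3 : forall k, z k ^+ 3 = 1.

Lemma cube_root_neq0 (x : algC) : x ^+ 3 = 1 -> x != 0.
Proof. by move=> x3; apply: contra_eq_neq x3 => ->; rewrite expr0n eq_sym oner_eq0. Qed.

Let z0 k : z k != 0. Proof. exact: cube_root_neq0. Qed.
Let Au k : anti (z k) \in unitmx. Proof. exact: anti_unit. Qed.

Let Ab k l : braided_mx (anti (z k)) (anti (z l)).
Proof. by apply: anti_braided; rewrite ?z3. Qed.

Lemma anti_SU k : SU (anti (z k)).
Proof.
split; last exact: det_anti.
have zc : (z k)^* = (z k)^-1.
  have n1 : `|z k| = 1.
    by apply/eqP; rewrite -(@pexpr_eq1 _ _ 3) // -normrX z3 normr1.
  by rewrite invC_norm n1 expr1n invr1 mul1r.
apply/matrixP => i j; rewrite !mxE !big_ord_recl big_ord0 !mxE.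
by case: i => [[|[|i]] lt_i] //; case: j => [[|[|j]] lt_j] //=;
  rewrite -?val_eqE /= ?rmorph0 ?rmorphN ?rmorphV ?unitfE //= ?zc ?invrK
    ?(mul0r, mulr0, addr0, add0r) ?mulrNN ?mulVf ?mulfV.
Qed.

Let evalw_parity w : let M := evalw (fun k => anti (z k)) w in
  if odd (size w) then M 0 0 = 0 /\ M 1 1 = 0 else M 0 1 = 0 /\ M 1 0 = 0.
Proof.
have antiE k (s : bool) i : (if s then invmx (anti (z k)) else anti (z k)) i i = 0.
  by case: s; rewrite ?invmx_anti // !mxE eqxx ?oppr0.
have l01 : lift ord0 ord0 = 1 :> 'I_2 by exact: val_inj.
elim: w => [|[x s] w IH] /=; first by rewrite !mxE.
rewrite !mxE !big_ord_recl !big_ord0 /= l01 !antiE !mul0r.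
by case: odd IH => /= -[-> ->]; rewrite !mulr0 !addr0.
Qed.

(** All the reflections are pairwise braided, which gives the knot relations. Commutators have even
    length, so their values are diagonal and commute. *)
Lemma dihedral_metab_SU_rep n m :
  metab_SU_rep n (trefoils m) (fun k => anti (z k)).
Proof.
split=> [k _|r [[i [lt_i ->]]|[a [b [c [f [_ ->]]]]]]]; first exact: anti_SU.
  by rewrite evalw_cat evalw_trefoils //= mulmx1 mulmxV.
apply: (evalw_comm_comm (g_unit := Au)); apply: val_inj => /=; rewrite -!evalw_geval.
have E u v : ~~ odd (size (comm u v)).
  by rewrite !size_cat !size_rev !size_map !oddD; do 2!case: odd.
have := evalw_parity (comm a b); have := evalw_parity (comm c f).
rewrite !(negPf (E _ _)) /=; move: (evalw _ _) (evalw _ _) => M N [M01 M10] [N01 N10].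
apply/matrixP => i j; rewrite !mxE !big_ord_recl !big_ord0.
have -> : lift ord0 ord0 = 1 :> 'I_2 by exact: val_inj.
have I2 (k : 'I_2) : k = 0 \/ k = 1.
  by case: k => [[|[|k]] lt_k] //; [left|right]; exact: val_inj.
by case: (I2 i) => ->; case: (I2 j) => ->; rewrite ?(M01, M10, N01, N10);
  rewrite ?(mul0r, mulr0, addr0, add0r) 1?mulrC.
Qed.

Lemma wada_dihedral m :
  wada m.+1 (trefoils m) (fun k => anti (z k)) =
  (\prod_(i < m) (tvar ^- 4 *
     (1 + tvar ^+ 2 * (1 - toQT (z i.+1 / z i + z i / z i.+1)) + tvar ^+ 4)))
  / \det (1%:M - twist_img (fun k => anti (z k)) 0).
Proof.
rewrite wada_trefoils //; congr (_ / _); apply: eq_bigr => i _.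
have fz k : toQT (z k) != 0 by rewrite fmorph_eq0.
rewrite !twist_imgE !map_anti.
rewrite det_alexander_anti // !detZ !det_anti // !mulr1.
by rewrite rmorphD !rmorphM !fmorphV opprD addrA -invfM -exprD.
Qed.

End DihedralRepresentation.

(** * Tensor products of two dihedral representations *)

Section KroneckerRepresentation.
Variables z u : nat -> algC.
Hypotheses (z3 : forall k, z k ^+ 3 = 1) (u3 : forall k, u k ^+ 3 = 1).

Let z0 k : z k != 0. Proof. exact: cube_root_neq0. Qed.
Let u0 k : u k != 0. Proof. exact: cube_root_neq0. Qed.

Let K k := kron (anti (z k)) (anti (u k)).

Let K_unit k : K k \in unitmx.
Proof.
have [] := @mulmx1_unit _ _ (K k) (kron (invmx (anti (z k))) (invmx (anti (u k)))) => //.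
by rewrite kron_mul !mulmxV ?anti_unit // kron1.
Qed.

Let K_braided k l : braided_mx (K k) (K l).
Proof.
rewrite /braided_mx /K !kron_mul.
by rewrite (anti_braided (y := z l)) ?z3 // (anti_braided (y := u l)) ?u3.
Qed.

(** Here [c] is r + 1/r, with r the ratio of consecutive values of the character a + b or a - b. *)
Definition kron_factor (c : algC) : QT := 1 + tvar ^+ 2 * (toQT c - 1) + tvar ^+ 4.

Lemma wada_kron_dihedral m :
  wada m.+1 (trefoils m) K =
  (\prod_(i < m) (tvar ^- 8 *
     (kron_factor (z i.+1 / z i * (u i.+1 / u i) + z i / z i.+1 * (u i / u i.+1)) *
      kron_factor (z i.+1 / z i * (u i / u i.+1) + z i / z i.+1 * (u i.+1 / u i)))))
  / \det (1%:M - twist_img K 0).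
Proof.
rewrite wada_trefoils //; congr (_ / _); apply: eq_bigr => i _.
rewrite /kron_factor 2!rmorphD !twist_imgE det_alexander_kron_anti //.
by rewrite !det_kron_anti // -invfM -exprD.
Qed.

End KroneckerRepresentation.

(** * Nonvanishing, and a test for inequality up to units *)

Lemma tofracQ_neq0 p x : p.[x] != 0 -> tofracQ p != 0.
Proof.
by rewrite /tofracQ tofrac_eq0; apply: contra_neq => ->; rewrite horner0.
Qed.

Lemma det_neq0_of_mul_scalar (F : fieldType) d (M N : 'M[F]_d) c :
  c != 0 -> M *m N = c%:M -> \det M != 0.
Proof.
move=> c0 /(congr1 determinant); rewrite det_mulmx det_scalar => E.
by have := expf_neq0 d c0; rewrite -E mulf_eq0 => /norP [].
Qed.

(** For an involution A, (1 - tA)(1 + tA) is the nonzero scalar 1 - t^2. As division by zero yields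
    zero, this keeps Wada's quotient from collapsing. *)
Lemma det_1_sub_twist_neq0 (A : nat -> 'M[algC]_(\sum_(i < 2) 2)) :
  A 0%N *m A 0%N = 1%:M -> \det (1%:M - twist_img A 0) != 0.
Proof.
move=> A2; have E : (1%:M - twist_img A 0) *m (1%:M + twist_img A 0)
    = (1 - tvar ^+ 2)%:M.
  rewrite mulmxDr mulmx1 mulmxBl mul1mx addrA subrK twist_imgE.
  by rewrite -scalemxAl -scalemxAr scalerA -map_mxM A2 map_mx1 -[RHS]scalemx1 scalerBl scale1r.
have nz : 1 - tvar ^+ 2 != 0.
  have -> : 1 - tvar ^+ 2 = tofracQ (1 - 'X^2) by rewrite /tofracQ rmorphB rmorph1 rmorphXn.
  by apply: (@tofracQ_neq0 _ 0); rewrite !hornerE expr0n subr0 oner_neq0.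
exact: det_neq0_of_mul_scalar nz E.
Qed.

(** Multiplying by a sign and a power of the variable does not affect vanishing at 1. *)
Lemma not_doteq (c : QT) (p q : {poly algC}) :
  c != 0 -> root p 1 -> ~~ root q 1 -> ~ doteq (c * tofracQ p) (c * tofracQ q).
Proof.
move=> c0; have main (s : bool) (k : nat) (a b : {poly algC}) :
    c * tofracQ a = (-1) ^+ s * tvar ^+ k * (c * tofracQ b) -> root a 1 = root b 1.
  rewrite mulrCA => /(mulfI c0) E.
  have {}E : a = (-1) ^+ s * 'X ^+ k * b.
    apply/eqP; rewrite -tofrac_eq !rmorphM !rmorphXn rmorphN rmorph1.
    apply/eqP; exact: E.
  by rewrite E !rootM !rootE !hornerE expr1n signr_eq0 oner_eq0.
move=> rp /negPf rq [s [k [/main|/main]]]; by rewrite rp rq.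
Qed.

(** * The example *)

Section Example.
Variable w : algC.
Hypotheses (w3 : w ^+ 3 = 1) (w1 : w != 1).

(* The coordinates of a character are the successive differences of the
   exponents of [w]: (1,-1,0) for [alpha'_root], (1,0,1) for [alpha_root] and
   (0,1,0) for [beta_root]. *)
Definition alpha'_root k : algC := if k == 1%N then w else 1.
Definition alpha_root k : algC :=
  match k with 1 | 2 => w | 3 => w^-1 | _ => 1 end.
Definition beta_root k : algC := if (k < 2)%N then 1 else w.

Lemma alpha'_root_cube k : alpha'_root k ^+ 3 = 1.
Proof. by rewrite /alpha'_root; case: eqP; rewrite ?expr1n. Qed.

Lemma alpha_root_cube k : alpha_root k ^+ 3 = 1.
Proof. by case: k => [|[|[|[|k]]]]; rewrite /= ?expr1n // exprVn w3 invr1. Qed.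

Lemma beta_root_cube k : beta_root k ^+ 3 = 1.
Proof. by rewrite /beta_root; case: ifP; rewrite ?expr1n. Qed.

Let w0 : w != 0. Proof. exact: cube_root_neq0. Qed.

Lemma evalw_slide (z : nat -> algC) k : (forall j, z j ^+ 3 = 1) ->
  evalw (fun j => anti (z j)) (slide 0 1 k) =
  anti (match k with
        | 2 => z 1%N / z 0%N * z 2%N
        | 3 => z 0%N / z 1%N * z 3%N
        | _ => z k
        end).
Proof.
move=> z3; have z0 j : z j != 0 by exact: cube_root_neq0.
by case: k => [|[|[|[|k]]]]; rewrite /= mulmx1 // anti_mul_inv_mul.
Qed.

Lemma slide_alpha' :
  (fun j => evalw (fun k => anti (alpha'_root k)) (slide 0 1 j)) =
  (fun j => anti (alpha_root j)).
Proof.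
apply: funext => k; rewrite evalw_slide; last exact: alpha'_root_cube.
by case: k => [|[|[|[|k]]]]; rewrite /alpha'_root /= ?invr1 ?mulr1 ?mul1r.
Qed.

(** The values at x_0 and x_1 coincide, so the factor inserted by [slide] acts trivially. *)
Lemma slide_beta :
  (fun j => evalw (fun k => anti (beta_root k)) (slide 0 1 j)) =
  (fun j => anti (beta_root j)).
Proof.
apply: funext => k; rewrite evalw_slide; last exact: beta_root_cube.
by case: k => [|[|[|[|k]]]]; rewrite /beta_root /= ?invr1 ?mulr1 ?mul1r.
Qed.

Let sum1 : w + w^-1 = -1.
Proof.
have : (w - 1) * (w ^+ 2 + w + 1) = w ^+ 3 - 1 by ring.
rewrite w3 subrr => /eqP; rewrite mulf_eq0 subr_eq0 (negPf w1) /= => /eqP E.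
apply: (mulIf w0); rewrite mulrDl mulVf // -expr2; apply/eqP.
by rewrite -subr_eq0 mulN1r opprK -E; apply/eqP; ring.
Qed.

Let w2 : w * w = w^-1.
Proof. by apply: (mulIf w0); rewrite mulVf // -expr2 -exprSr w3. Qed.

Let wV2 : w^-1 * w^-1 = w.
Proof. by rewrite -invfM w2 invrK. Qed.

(** Both supports have size two, so the two products differ only in the order of their factors. *)
Lemma doteq_alpha :
  doteq (wada 4 (trefoils 3) (fun j => anti (alpha_root j)))
        (wada 4 (trefoils 3) (fun j => anti (alpha'_root j))).
Proof.
exists false, 0%N; left; rewrite !expr0 !mul1r.
rewrite !wada_dihedral; [|exact: alpha'_root_cube|exact: alpha_root_cube].
congr (_ / _).
rewrite !big_ord_recl !big_ord0 /= /alpha'_root /=.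
rewrite !(divr1, div1r) divff // [w^-1 + w]addrC wV2 invrK w2.
rewrite sum1 !mulr1; congr (_ * _); exact: mulrC.
Qed.

Let unit_part : QT := tvar ^- 8 ^+ 3 * kron_factor (-1) ^+ 3 /
  \det (1%:M - twist_img (fun=> kron (anti 1) (anti 1)) 0).

Let regroup (R : comNzRingType) (a g h d : R) :
  (a * (g * g) * (a * (g * g) * (a * (g * g))) * d = a ^+ 3 * g ^+ 3 * d * g ^+ 3) *
  (a * (g * g) * (a * (h * g) * (a * (h * h))) * d = a ^+ 3 * g ^+ 3 * d * h ^+ 3).
Proof. by split; ring. Qed.

(** The supports (1,0,1) and (0,1,0) are disjoint and cover all three coordinates, so a + b and a -
    b vanish nowhere: all six factors are [kron_factor (-1)]. *)
Lemma wada_kron_alpha :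
  wada 4 (trefoils 3) (fun j => kron (anti (alpha_root j)) (anti (beta_root j))) =
  unit_part * kron_factor (-1) ^+ 3.
Proof.
rewrite wada_kron_dihedral; [|exact: alpha_root_cube|exact: beta_root_cube].
rewrite !big_ord_recl !big_ord0 /= /beta_root /=.
rewrite !(divr1, div1r, mulr1, mul1r) divff // invrK wV2 w2.
rewrite !(divr1, div1r, mulr1, mul1r) [w^-1 + w]addrC sum1.
exact: (regroup _ _ 0 _).1.
Qed.

(** For (1,-1,0) and (0,1,0), a + b vanishes at the second coordinate and both a + b and a - b at
    the third, which gives three factors [kron_factor 2]. *)
Lemma wada_kron_alpha' :
  wada 4 (trefoils 3) (fun j => kron (anti (alpha'_root j)) (anti (beta_root j))) =
  unit_part * kron_factor 2 ^+ 3.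
Proof.
rewrite wada_kron_dihedral; [|exact: alpha'_root_cube|exact: beta_root_cube].
rewrite !big_ord_recl !big_ord0 /= /alpha'_root /beta_root /=.
rewrite !(divr1, div1r, mulr1, mul1r) ?divff // ?mulVf // ?invrK ?wV2 ?w2;
  last exact: oner_neq0.
rewrite ?(divr1, div1r, mulr1, mul1r) ?[w^-1 + w]addrC ?sum1.
exact: (regroup _ _ _ _).2.
Qed.

Let kron_factor_identity (R : comNzRingType) (t : R) :
  (1 + t ^+ 2 * (-1 - 1) + t ^+ 4 = (t ^+ 2 - 1) ^+ 2) *
  (1 + t ^+ 2 * (1 + 1 - 1) + t ^+ 4 = t ^+ 4 + t ^+ 2 + 1).
Proof. by split; ring. Qed.

Let kron_factorE : (kron_factor (-1) = tofracQ (('X^2 - 1) ^+ 2)) *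
  (kron_factor 2 = tofracQ ('X^4 + 'X^2 + 1)).
Proof.
rewrite /kron_factor /tofracQ !(rmorphB, rmorphD, rmorphXn, rmorphN, rmorph1) /=.
exact: kron_factor_identity.
Qed.

Let unit_part_neq0 : unit_part != 0.
Proof.
apply: mulf_neq0; last first.
  apply: invr_neq0; apply: det_1_sub_twist_neq0.
  (* Each tensor factor squares to -1, and the two signs cancel. *)
  rewrite kron_mul !anti_sqr ?oner_neq0 // kron_opp.
  exact: kron1.
apply: mulf_neq0; apply: expf_neq0.
  by apply: invr_neq0; apply: expf_neq0; exact: tvar_neq0.
rewrite kron_factorE.1; apply: (@tofracQ_neq0 _ 0).
by rewrite !hornerE expr0n /= sub0r sqrrN expr1n oner_neq0.
Qed.

(** At t = 1 the polynomial (t^2 - 1)^2 vanishes, while t^4 + t^2 + 1 takes the value 3. *)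
Lemma not_doteq_kron : ~ doteq
  (wada 4 (trefoils 3) (fun j => kron (anti (alpha_root j)) (anti (beta_root j))))
  (wada 4 (trefoils 3) (fun j => kron (anti (alpha'_root j)) (anti (beta_root j)))).
Proof.
rewrite wada_kron_alpha wada_kron_alpha' !kron_factorE.
have tX p : tofracQ p ^+ 3 = tofracQ (p ^+ 3) by rewrite /tofracQ rmorphXn.
rewrite !tX.
apply: not_doteq; first exact: unit_part_neq0.
  by rewrite rootE !hornerE expr1n subrr !expr0n.
rewrite rootE !hornerE !expr1n expf_eq0 /=.
have -> : 1 + 1 + 1 = 3%:R :> algC by ring.
by rewrite pnatr_eq0.
Qed.

End Example.

Theorem theorem4p1 :
  exists (n : nat) (b : braid) (n' : nat) (b' : braid),
    knot_braid n b /\ knot_braid n' b' /\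
    exists (w v : nat -> word), metab_iso n b n' b' w v /\
    exists (n1 n2 : nat) (A' : nat -> 'M[algC]_n1) (B' : nat -> 'M[algC]_n2),
      [/\ (0 < n1)%N, (0 < n2)%N, metab_SU_rep n' b' A' & metab_SU_rep n' b' B'] /\
      let A := fun j => evalw A' (w j) in
      let B := fun j => evalw B' (w j) in
      [/\ doteq (wada n b A) (wada n' b' A'),
          doteq (wada n b B) (wada n' b' B')
        & ~ doteq (wada n b (fun j => kron (A j) (B j)))
                  (wada n' b' (fun j => kron (A' j) (B' j)))].
Proof.
have [w w_prim] := C_prim_root_exists (isT : (0 < 3)%N).
have w3 : w ^+ 3 = 1 := prim_expr_order w_prim.
have w1 : w != 1 by rewrite -(expr1 w) -(prim_order_dvd w_prim).
exists 4, (trefoils 3), 4, (trefoils 3).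
do 2 (split; first exact: trefoils3_knot).
exists (slide 0 1), (slide 1 0); split; first exact: slide_metab_iso.
exists 2, 2, (fun j => anti (alpha'_root w j)), (fun j => anti (beta_root w j)); split.
  by split=> //; apply: dihedral_metab_SU_rep; [exact: alpha'_root_cube|exact: beta_root_cube].
have EA := slide_alpha' w3; have EB := slide_beta w3.
move=> A B; have -> : A = fun j => anti (alpha_root w j) by exact: EA.
have -> : B = fun j => anti (beta_root w j) by exact: EB.
split; [exact: doteq_alpha| |exact: not_doteq_kron].
by exists false, 0%N; left; rewrite !expr0 !mul1r.
Qed.
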